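(* Let $Q$ be a positive-definite quadratic form on $\mathbb R^4$ (with lattice $L=\mathbb Z^4$) all of whose conorms $\lambda_e(Q)$, $0\neq e\in(\mathbb F_2^4)^*$, are nonnegative. Let $(m_1,m_2,m_3;N)$ be any Schottky--Igusa datum with $\dim N'\le 2$. Then the associated tropical Schottky--Igusa condition holds: the maximum $$\max\{\pi_1^{\mathrm{trop}},\pi_2^{\mathrm{trop}},\pi_3^{\mathrm{trop}}\}$$ is attained at least twice. In particular, the conditions coming from data with $\dim N'\le 2$ do not cut the tropical Igusa locus (the set of positive-definite forms on $\mathbb R^4$ with all conorms nonnegative) any further.
   Context: For $u\in\mathbb F_2^4=\mathbb Z^4/2\mathbb Z^4$ let $\mu_Q(u)=\min\{Q[x]:x\in\mathbb Z^4,\ x\equiv u \bmod 2\}$. The conorms (genus $g=4$) are $\lambda_e(Q)=-2^{-3}\sum_{u\in\mathbb F_2^4}(-1)^{e(u)}\mu_Q(u)$ for $0\ne e\in\mathrm{Hom}(\mathbb F_2^4,\mathbb F_2)$. The tropical theta constants are $\Theta_u(Q)=-\tfrac14\mu_Q(u)$. A characteristic is $m=(m',m'')\in\mathbb F_2^4\times\mathbb F_2^4$; put $q(m)=m'\cdot m''\in\mathbb F_2$. It is even if $q(m)=0$ and odd otherwise. A triple $m_1,m_2,m_3$ is azygetic if $q(m_1)+q(m_2)+q(m_3)+q(m_1+m_2+m_3)=1$ in $\mathbb F_2$. A Schottky--Igusa datum $(m_1,m_2,m_3;N)$ consists of an azygetic triple of characteristics $m_1,m_2,m_3\in\mathbb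 F_2^8$ and a $3$-dimensional $\mathbb F_2$-subspace $N\subseteq\mathbb F_2^4\times\mathbb F_2^4$ such that every element of $(m_1+N)\cup(m_2+N)\cup(m_3+N)$ is even. $N'\subseteq\mathbb F_2^4$ denotes the image of $N$ under the first projection $m\mapsto m'$. The tropical theta products are $$\pi_i^{\mathrm{trop}}=\sum_{m\in m_i+N}\Theta_{m'}(Q),\qquad i=1,2,3.$$ *)

(* Defs.v *)
From HB Require Import structures.
From mathcomp Require Import all_boot all_order all_algebra.
From mathcomp Require Import boolp classical_sets reals.
From mathcomp Require Import zify ring.

Set Implicit Arguments.
Unset Strict Implicit.
Unset Printing Implicit Defensive.

Import Order.TTheory GRing.Theory Num.Theory.
Local Open Scope ring_scope.

Notation F2_4 := 'rV['F_2]_4.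
Notation characteristic := ('rV['F_2]_4 * 'rV['F_2]_4)%type.

Definition qf (R : realType) (Q : 'M[R]_4) (x : 'rV[R]_4) : R :=
  (x *m Q *m x^T) 0 0.

(* Quadratic forms on R^4 are represented by their symmetric Gram matrices. *)
Definition posdef (R : realType) (Q : 'M[R]_4) : Prop :=
  Q^T = Q /\ (forall x : 'rV[R]_4, x != 0 -> 0 < qf Q x).

Definition coset_values (R : realType) (Q : 'M[R]_4) (u : F2_4) : set R :=
  [set qf Q (map_mx intr x) |
    x in [set x : 'rV[int]_4 | map_mx intr x = u]]%classic.

(* When [Q] is positive definite this infimum is a minimum, see [mu_min]. *)
Definition mu (R : realType) (Q : 'M[R]_4) (u : F2_4) : R :=
  inf (coset_values Q u).

Lemma qf_ge0 (R : realType) (Q : 'M[R]_4) x : posdef Q -> 0 <= qf Q x.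
Proof.
move=> [_ Qp]; have [->|/Qp/ltW//] := eqVneq x 0.
by rewrite /qf !mul0mx mxE.
Qed.

(* Cauchy-Schwarz for x and e_i Q^-1. *)
Lemma posdef_coord_bound (R : realType) (Q : 'M[R]_4) (i : 'I_4) : posdef Q ->
  exists d : R, 0 < d /\ forall x : 'rV[R]_4, x 0 i ^+ 2 <= qf Q x * d.
Proof.
move=> Qpd; have [Qs Qp] := Qpd.
have Qu : Q \in unitmx.
  rewrite -row_free_unit -kermx_eq0; apply/eqP/row_matrixP => j.
  rewrite row0; apply/eqP; apply: contraT => /Qp.
  have kQ : row j (kermx Q) *m Q = 0 by rewrite -row_mul mulmx_ker row0.
  by rewrite /qf kQ mul0mx mxE ltxx.
pose y : 'rV[R]_4 := delta_mx 0 i *m invmx Q.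
have yQ : y *m Q = delta_mx 0 i by rewrite mulmxKV.
have y0 : y != 0.
  apply/eqP => y0; move: yQ; rewrite y0 mul0mx => /rowP/(_ i)/eqP.
  by rewrite !mxE !eqxx eq_sym oner_eq0.
exists (qf Q y); split; first exact: Qp.
move=> x.
have xQy : (x *m Q *m y^T) 0 0 = x 0 i.
  rewrite -mulmxA -{1}Qs -trmx_mul yQ trmx_delta.
  rewrite mxE (bigD1 i) //= big1 => [|j ji].
    by rewrite addr0 mxE !eqxx mulr1.
  by rewrite mxE (negPf ji) mulr0.
have yQx : (y *m Q *m x^T) 0 0 = x 0 i.
  rewrite yQ mxE (bigD1 i) //= big1 => [|j ji].
    by rewrite addr0 !mxE !eqxx mul1r.
  by rewrite mxE (negPf ji) andbF mul0r.
have d0 := Qp _ y0; set d := qf Q y in d0 *.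
have E t : qf Q (x + t *: y) = qf Q x + 2 * t * x 0 i + t ^+ 2 * d.
  rewrite /d /qf [(x + _)^T]linearD !mulmxDl !mulmxDr linearZ /=
    -!scalemxAl -!scalemxAr.
  rewrite ?scalerA [LHS]mxE ![(_ + _ : 'M__) 0 0]mxE ![(_ *: _ : 'M__) 0 0]mxE.
  by rewrite xQy yQx; ring.
have := qf_ge0 (x + (- (x 0 i / d)) *: y) Qpd; rewrite E.
have dn0 : d != 0 by rewrite gt_eqF.
have -> : qf Q x + 2 * - (x 0 i / d) * x 0 i + (- (x 0 i / d)) ^+ 2 * d =
          qf Q x - x 0 i ^+ 2 / d by field.
by rewrite subr_ge0 ler_pdivrMr.
Qed.

Lemma mu_min (R : realType) (Q : 'M[R]_4) (u : F2_4) : posdef Q ->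
  coset_values Q u (mu Q u) /\ lbound (coset_values Q u) (mu Q u).
Proof.
move=> Qpd.
pose x0 : 'rV[int]_4 := map_mx (fun a : 'F_2 => (a : nat)%:Z) u.
have x0u : map_mx intr x0 = u.
  by apply/rowP => j; rewrite !mxE -pmulrn natr_Zp.
pose c := qf Q (map_mx intr x0).
have [B HB] : exists B : nat, forall x : 'rV[int]_4,
    qf Q (map_mx intr x) <= c -> forall i, (absz (x 0%R i) <= B)%N.
  suff /choice[B HB] : forall i : 'I_4, exists b : nat, forall x : 'rV[int]_4,
      qf Q (map_mx intr x) <= c -> (absz (x 0%R i) <= b)%N.
    exists (\max_i B i)%N => x xc i.
    by rewrite (leq_trans (HB i x xc)) // leq_bigmax.
  move=> i; have [d [d0 Hd]] := posdef_coord_bound i Qpd.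
  exists (Num.bound (c * d)) => x xc.
  have := Hd (map_mx intr x); rewrite mxE => h.
  have {}h : (x 0 i)%:~R ^+ 2 <= c * d :> R.
    by apply: (le_trans h); rewrite ler_pM2r.
  have cd0 : 0 <= c * d by apply: le_trans h; exact: sqr_ge0.
  have := archi_boundP cd0; move/(le_lt_trans h).
  rewrite -rmorphXn /= -[X in _ < X]mulrz_nat ltr_int => {}h.
  rewrite leqNgt; apply/negP => k; move: h; rewrite expr2.
  by nia.
pose pt (k : {ffun 'I_4 -> 'I_(B + B).+1}) : 'rV[int]_4 :=
  \row_i ((k i : nat)%:Z - B%:Z).
have ptP x : qf Q (map_mx intr x) <= c -> exists k, pt k = x.
  move=> /HB xB; exists [ffun i => inord (absz (x 0%R i + B%:Z)%R)].
  apply/rowP => i; rewrite mxE ffunE inordK; have := xB i; first by lia.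
  by lia.
have [k0 k0E] := ptP x0 (lexx _).
pose P k := map_mx intr (pt k) == u.
have Pk0 : P k0 by rewrite /P k0E x0u.
case: (arg_minP (fun k => qf Q (map_mx intr (pt k))) Pk0) => k /eqP Pk kmin.
pose v := qf Q (map_mx intr (pt k)).
have vS : coset_values Q u v by exists (pt k).
have vlb : lbound (coset_values Q u) v.
  move=> _ [x xu <-].
  have [xc|/ltW cx] := leP (qf Q (map_mx intr x)) c.
    have [l lE] := ptP x xc; rewrite -lE; apply: kmin.
    by rewrite /P lE; apply/eqP.
  by apply: le_trans cx; rewrite /c -k0E; exact: kmin.
suff -> : mu Q u = v by [].
apply/le_anti/andP; split.
  by apply: ge_inf => //; exists v.
by apply: lb_le_inf => //; exists v.
Qed.

Definition conorm (R : realType) (Q : 'M[R]_4) (e : 'Hom(F2_4, ('F_2)^o)) : R :=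
  - (2 ^+ 3)^-1 * \sum_(u : F2_4) (-1) ^+ (e u : 'F_2) * mu Q u.

Definition Theta (R : realType) (Q : 'M[R]_4) (u : F2_4) : R :=
  - (4^-1) * mu Q u.

Definition igusa_locus (R : realType) : set 'M[R]_4 :=
  [set Q : 'M[R]_4 | posdef Q /\
    forall e : 'Hom(F2_4, ('F_2)^o), e != 0 -> 0 <= conorm Q e]%classic.

Arguments igusa_locus : clear implicits.

Definition qchar (m : characteristic) : 'F_2 := \sum_i m.1 0 i * m.2 0 i.

Definition even_char (m : characteristic) : bool := qchar m == 0.

Definition azygetic (m1 m2 m3 : characteristic) : bool :=
  qchar m1 + qchar m2 + qchar m3 + qchar (m1 + m2 + m3) == 1.

Definition translate (m : characteristic) (N : {vspace characteristic}) :
    {set characteristic} := [set m + n | n in N]%SET.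

Definition schottky_igusa (m1 m2 m3 : characteristic)
    (N : {vspace characteristic}) : Prop :=
  [/\ azygetic m1 m2 m3, \dim N = 3%N &
      forall m, m \in (translate m1 N :|: translate m2 N :|: translate m3 N)%SET ->
        even_char m].

(* N', the image of N under m = (m', m'') |-> m'. *)
Definition fst_image (N : {vspace characteristic}) : {vspace F2_4} :=
  (linfun (@fst F2_4 F2_4) @: N)%VS.

Definition trop_prod (R : realType) (Q : 'M[R]_4) (m : characteristic)
    (N : {vspace characteristic}) : R :=
  \sum_(n in translate m N) Theta Q n.1.

Definition max_attained_twice (R : realType) (a b c : R) : Prop :=
  let M := Num.max a (Num.max b c) in
  [\/ a = M /\ b = M, a = M /\ c = M | b = M /\ c = M].

Definition trop_condition (R : realType) (Q : 'M[R]_4)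
    (m1 m2 m3 : characteristic) (N : {vspace characteristic}) : Prop :=
  max_attained_twice (trop_prod Q m1 N) (trop_prod Q m2 N) (trop_prod Q m3 N).

(* Main.v *)
Require Import Defs.
From HB Require Import structures.
From mathcomp Require Import all_boot all_order all_algebra.
From mathcomp Require Import classical_sets reals.
From mathcomp Require Import ring.

(** Fourier inversion on F_2^4 turns the definition of the conorms into
    mu(u) = - 1/2 \sum_w (-1)^(w.u) lambda_w ([mu_lambda]).  Substituting this
    in a theta product and summing over N kills every w that does not vanish
    on N', which leaves ([trop_prod_lambda])
      pi_i = |N|/8 \sum_(w in N'^perp) (-1)^(w.m_i') lambda_w.
    As the conorms are nonnegative, pi_i is largest possible when m_i' is
    annihilated by all of N'^perp; so it is enough that this happens for two of
    the three indices i.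

    This is a fact of symplectic geometry over F_2 ([two_annihilated]).  Since
    q vanishes on m_i + N, the subspace N is totally isotropic and orthogonal
    to the differences m_i + m_j, and azygeticity says that
    <m1 + m2, m1 + m3> = 1.  As dim N = 3 in a symplectic space of dimension 8,
    the space N^perp / N is a hyperbolic plane, generated by m1 + m2 and
    m1 + m3 ([orth_isotropic_codim1]).  A vector w of N'^perp gives a vector
    (0, w) of N^perp, which lies in one of four cosets of N, and
    q(m_i + (0, w)) = w.m_i'.  When this is 1, the coset can only be
    m_j + m_k + N with {i, j, k} = {1, 2, 3} ([symp1_mem_coset]).  The vectors
    (0, w) are mutually orthogonal while the cosets m_j + m_k + N and
    m_i + m_k + N are not, so only one index i can occur
    ([annihilator_sees_one]). *)

Set Implicit Arguments.
Unset Strict Implicit.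
Unset Printing Implicit Defensive.

Import Order.TTheory GRing.Theory Num.Theory.
Local Open Scope ring_scope.

(** * The dot product and the symplectic form over F_2 *)

Definition dot (g : nat) (x y : 'rV['F_2]_g) : 'F_2 := \sum_i x 0 i * y 0 i.

Definition symp (g : nat) (m n : 'rV['F_2]_g * 'rV['F_2]_g) : 'F_2 :=
  dot m.1 n.2 + dot m.2 n.1.

Lemma F2_eq01 (a : 'F_2) : a = 0 \/ a = 1.
Proof. by case: a => -[|[|[]]] //= i; [left|right]; apply: val_inj. Qed.

Lemma addF2r (a : 'F_2) : a + a = 0.
Proof. by case: (F2_eq01 a) => ->; apply: val_inj. Qed.

Lemma addF2 (V : lmodType 'F_2) (v : V) : v + v = 0.
Proof. by rewrite -mulr2n -scaler_nat (_ : 2%:R = 0) ?scale0r //; apply: val_inj. Qed.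

Lemma dotC g (x y : 'rV['F_2]_g) : dot x y = dot y x.
Proof. by apply: eq_bigr => i _; rewrite mulrC. Qed.

Lemma dotDl g (x y z : 'rV['F_2]_g) : dot (x + y) z = dot x z + dot y z.
Proof. by rewrite /dot -big_split; apply: eq_bigr => i _; rewrite mxE mulrDl. Qed.

Lemma dotDr g (x y z : 'rV['F_2]_g) : dot z (x + y) = dot z x + dot z y.
Proof. by rewrite dotC dotDl !(dotC z). Qed.

Lemma dotZl g a (x y : 'rV['F_2]_g) : dot (a *: x) y = a * dot x y.
Proof. by rewrite /dot mulr_sumr; apply: eq_bigr => i _; rewrite mxE mulrA. Qed.

Lemma dot_delta g (x : 'rV['F_2]_g) i : dot (delta_mx 0 i) x = x 0 i.
Proof.
rewrite /dot (bigD1 i) //= mxE !eqxx mul1r big1 ?addr0 // => j ji.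
by rewrite mxE (negPf ji) andbF mul0r.
Qed.

Lemma dot0l g (x : 'rV['F_2]_g) : dot 0 x = 0.
Proof. by rewrite -(scale0r 0) dotZl mul0r. Qed.

Lemma sum_row_mx (S : pzRingType) n p q (F : 'I_n -> 'rV[S]_p)
    (G : 'I_n -> 'rV[S]_q) :
  \sum_i row_mx (F i) (G i) = row_mx (\sum_i F i) (\sum_i G i).
Proof.
by elim/big_rec3: _ => [|i x y z _ ->]; rewrite ?row_mx0 ?add_row_mx.
Qed.

Section Symplectic.
Variable g : nat.
Local Notation V := ('rV['F_2]_g * 'rV['F_2]_g)%type.
Implicit Types (m n p v x y : V) (U N : {vspace V}).

Lemma sympC m n : symp m n = symp n m.
Proof. by rewrite /symp addrC dotC (dotC m.1). Qed.

Lemma sympDl m n p : symp (m + n) p = symp m p + symp n p.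
Proof. by rewrite /symp !dotDl addrACA. Qed.

Lemma sympDr m n p : symp p (m + n) = symp p m + symp p n.
Proof. by rewrite sympC sympDl !(sympC p). Qed.

Lemma sympZl a m p : symp (a *: m) p = a * symp m p.
Proof. by rewrite /symp !dotZl mulrDr. Qed.

Lemma sympZr a m p : symp p (a *: m) = a * symp p m.
Proof. by rewrite sympC sympZl sympC. Qed.

Lemma sympvv m : symp m m = 0.
Proof. by rewrite /symp (dotC m.2); exact: addF2r. Qed.

Definition isotropic U := {in U &, forall m n, symp m n = 0}.

Lemma isotropic_addv U v : isotropic U -> {in U, forall n, symp v n = 0} ->
  isotropic (U + <[v]>)%VS.
Proof.
move=> Ui Uv m' n' /memv_addP[m mU [_ /vlineP[a ->] ->]].
move=> /memv_addP[n nU [_ /vlineP[b ->] ->]].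
rewrite !(sympDl, sympDr) !(sympZl, sympZr) sympvv Ui // (sympC m) !Uv //.
by rewrite !mulr0 !addr0.
Qed.

(** The rows of A and B are the vectors of a basis of U and the same vectors
    with their two halves exchanged; the Gram matrix of the symplectic form on
    U is A *m B^T, so isotropy bounds rank A + rank B = 2 dim U by 2 g. *)
Lemma dim_isotropic U : isotropic U -> (\dim U <= g)%N.
Proof.
move=> Ui; pose b := vbasis U.
have bf : free b := basis_free (vbasisP U).
pose A := \matrix_(i < \dim U) row_mx (b`_i).1 (b`_i).2.
pose B := \matrix_(i < \dim U) row_mx (b`_i).2 (b`_i).1.
have AE (c : 'rV_(\dim U)) : c *m A =
    row_mx (\sum_i c 0 i *: b`_i).1 (\sum_i c 0 i *: b`_i).2.
  rewrite (raddf_sum fst) (raddf_sum snd) -sum_row_mx mulmx_sum_row.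
  by apply: eq_bigr => i _; rewrite rowK scale_row_mx.
have BE (c : 'rV_(\dim U)) : c *m B =
    row_mx (\sum_i c 0 i *: b`_i).2 (\sum_i c 0 i *: b`_i).1.
  rewrite (raddf_sum fst) (raddf_sum snd) -sum_row_mx mulmx_sum_row.
  by apply: eq_bigr => i _; rewrite rowK scale_row_mx.
have b_inj (c : 'rV_(\dim U)) : \sum_i c 0 i *: b`_i == 0 -> c = 0.
  by move=> /eqP c0; apply/rowP => i; rewrite mxE (freeP bf _ c0).
have rA : \rank A = \dim U.
  apply/eqP/inj_row_free => c /eqP.
  by rewrite AE row_mx_eq0 => cA; apply: b_inj.
have rB : \rank B = \dim U.
  apply/eqP/inj_row_free => c /eqP.
  by rewrite BE row_mx_eq0 andbC => cB; apply: b_inj.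
have bU (i : 'I_(\dim U)) : b`_i \in U.
  by apply/vbasis_mem/mem_nth; rewrite size_tuple.
have /mulmx0_rank_max : A *m B^T = 0.
  apply/matrixP => i j; rewrite !mxE big_split_ord /=.
  rewrite -[RHS](Ui b`_i b`_j) //.
  by congr (_ + _); apply: eq_bigr => k _;
    rewrite !mxE ?(unsplitK (inl k)) ?(unsplitK (inr k)).
by rewrite mxrank_tr rA rB !addnn leq_double.
Qed.

(** The vector in the conclusion is v minus its projection to the hyperbolic
    plane spanned by x and y, hence is orthogonal to N, x and y.  Were it outside N, adding
    it and then x to N would give an isotropic subspace of dimension
    dim N + 2 > g. *)
Lemma orth_isotropic_codim1 N x y v : isotropic N -> (g <= (\dim N).+1)%N ->
  {in N, forall n, [/\ symp x n = 0, symp y n = 0 & symp v n = 0]} ->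
  symp x y = 1 -> v + symp v y *: x + symp v x *: y \in N.
Proof.
move=> Ni dN h xy; set w := v + _ + _.
have wN n : n \in N -> symp w n = 0.
  by move=> /h[xn yn vn]; rewrite !sympDl !sympZl xn yn vn !mulr0 !addr0.
have wx : symp w x = 0.
  by rewrite !sympDl !sympZl sympvv (sympC y) xy mulr0 addr0 mulr1; apply: addF2r.
have wy : symp w y = 0.
  by rewrite !sympDl !sympZl sympvv xy mulr0 addr0 mulr1; apply: addF2r.
apply: contraT => wNN.
pose W := (N + <[w]>)%VS.
have Wi : isotropic W by apply: isotropic_addv.
have Wx : isotropic (W + <[x]>)%VS.
  apply: isotropic_addv => // _ /memv_addP[n /h[xn _ _] [_ /vlineP[a ->] ->]].
  by rewrite sympDr sympZr xn sympC wx mulr0 addr0.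
have ltW (U : {vspace V}) u : u \notin U -> (\dim U < \dim (U + <[u]>)%VS)%N.
  move=> uU; rewrite ltn_neqAle dimv_leqif_sup ?addvSl // dimvS ?addvSl // andbT.
  by rewrite subv_add subvv.
have xW : x \notin W.
  apply/negP => /memv_addP[n /h[_ yn _] [_ /vlineP[a ->]]] xE.
  by move: xy; rewrite xE sympDl sympZl wy sympC yn mulr0 addr0.
have := leq_trans (ltW _ _ xW) (dim_isotropic Wx).
by rewrite ltnNge (leq_trans dN) // ltW.
Qed.

End Symplectic.

(** * Fourier analysis of the theta products *)

Lemma qcharD (m n : characteristic) :
  qchar (m + n) = qchar m + qchar n + symp m n.
Proof.
have qE (p : characteristic) : qchar p = dot p.1 p.2 by [].
by rewrite !qE /symp dotDl !dotDr (dotC n.1 m.2); ring.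
Qed.

Lemma signF2D (R : pzRingType) (a b : 'F_2) :
  (-1) ^+ (a + b)%R = (-1) ^+ a * (-1) ^+ b :> R.
Proof.
by case: (F2_eq01 a) => ->; case: (F2_eq01 b) => ->;
  rewrite /= ?expr1 ?mulrNN ?mulr1 ?mul1r.
Qed.

(** Orthogonality of characters, with the translation by a vector on which the
    character is -1 replaced by an arbitrary sign-reversing bijection h. *)
Lemma sum_signF2_eq0 (R : numDomainType) (I : finType) (A : {pred I})
    (f : I -> 'F_2) (h : I -> I) :
  injective h -> (forall x, (h x \in A) = (x \in A)) ->
  (forall x, f (h x) = 1 + f x) -> \sum_(x in A) (-1) ^+ f x = 0 :> R.
Proof.
move=> h_inj hA fh; set S := \sum_(x in A) _.
have SN : S = - S.
  rewrite {1}/S (reindex_inj h_inj) /= -sumrN.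
  by apply: eq_big => // x _; rewrite fh signF2D expr1 mulN1r.
have : S *+ 2 == 0 by rewrite mulr2n {1}SN addNr.
by rewrite mulrn_eq0 => /eqP.
Qed.

(** The functionals w.x, with values in the module for which they are elements
    of the homomorphism type that indexes the conorms. *)
Definition dual_lin (w : F2_4) : F2_4 -> ('F_2)^o := dot w.

Lemma dual_lin_is_linear w : linear (dual_lin w).
Proof. by move=> a x y; rewrite /dual_lin dotDr dotC dotZl dotC. Qed.

HB.instance Definition _ w :=
  GRing.isLinear.Build 'F_2 F2_4 ('F_2)^o _ (dual_lin w)
    (dual_lin_is_linear w).

Section Conorms.
Variables (R : realType) (Q : 'M[R]_4).
Implicit Types (u w : F2_4) (m : characteristic) (N : {vspace characteristic}).

(** The conorms indexed by vectors instead of functionals; the value at 0, which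
    is not a conorm, completes the Fourier transform. *)
Definition lambda w : R :=
  - (2 ^+ 3)^-1 * \sum_(u : F2_4) (-1) ^+ dot w u * mu Q u.

Lemma lambda_ge0 w :
  (forall e : 'Hom(F2_4, ('F_2)^o), e != 0 -> 0 <= conorm Q e) ->
  w != 0 -> 0 <= lambda w.
Proof.
move=> Qge0 w0.
have -> : lambda w = conorm Q (linfun (dual_lin w)).
  by congr (_ * _); apply: eq_bigr => u _; rewrite lfunE.
apply: Qge0; apply: contra_neq w0 => e0; apply/rowP => i.
have : linfun (dual_lin w) (delta_mx 0 i) = 0 by rewrite e0 lfunE.
by rewrite lfunE /= /dual_lin dotC dot_delta mxE.
Qed.

(** Fourier inversion: the sum over w of (-1)^(w.(u + v)) is 16 if u = v and
    vanishes otherwise. *)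
Lemma mu_lambda u : mu Q u = - 2^-1 * \sum_w (-1) ^+ dot w u * lambda w.
Proof.
have orth v : \sum_w (-1) ^+ dot w (u + v) = if v == u then 16 else 0 :> R.
  case: eqVneq => [->|uv].
    rewrite addF2 (eq_bigr (fun=> 1)) => [|w _]; last by rewrite dotC dot0l.
    by rewrite sumr_const card_mx card_Fp.
  have [i ui] : exists i, (u + v) 0 i = 1.
    have /rV0Pn[i ui] : u + v != 0.
      by apply: contra_neq uv => uv0; rewrite -[v]add0r -uv0 -addrA addF2 addr0.
    by exists i; case: (F2_eq01 ((u + v) 0 i)) ui => // ->; rewrite eqxx.
  apply: (@sum_signF2_eq0 _ _ _ _ (+%R (delta_mx 0 i))) => //.
    exact: addrI.
  by move=> w; rewrite dotDl dot_delta ui.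
under eq_bigr do rewrite mulrCA mulr_sumr.
rewrite -mulr_sumr exchange_big /=.
under eq_bigr => v _.
  under eq_bigr => w _ do rewrite mulrA -signF2D -dotDr.
  rewrite -mulr_suml orth; over.
rewrite (bigD1 u) //= eqxx big1 => [|v /negPf->]; last by rewrite mul0r.
by field.
Qed.

(** The orthogonal of N' for the dot product. *)
Definition annihilates N w := [forall n in N, dot w n.1 == 0].

Lemma trop_prod_lambda m N : trop_prod Q m N =
  #|N|%:R / 8 * \sum_(w | annihilates N w) (-1) ^+ dot w m.1 * lambda w.
Proof.
have inner w : \sum_(n in N) (-1) ^+ dot w n.1 =
    if annihilates N w then #|N|%:R else 0 :> R.
  case: ifPn => [/forall_inP wN|/forall_inPn[n nN wn]].
    rewrite (eq_bigr (fun=> 1)) ?sumr_const // => n /wN/eqP->.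
    by rewrite expr0.
  apply: (@sum_signF2_eq0 _ _ _ _ (+%R n)); first exact: addrI.
    by move=> x; rewrite rpredDl.
  move=> x; rewrite dotDr; congr (_ + _).
  by case: (F2_eq01 (dot w n.1)) wn => ->; rewrite ?eqxx.
rewrite /trop_prod /translate big_imset /=; last by move=> x y _ _ /addrI.
rewrite /Theta.
under eq_bigr => n _.
  rewrite mu_lambda mulrA mulrNN mulr_sumr.
  under eq_bigr => w _ do rewrite dotDr signF2D.
  over.
rewrite exchange_big /= mulr_sumr [RHS]big_mkcond /=.
apply: eq_bigr => w _.
transitivity (\sum_(n in N) (-1) ^+ dot w n.1 *
    (8^-1 * ((-1) ^+ dot w m.1 * lambda w))).
  by apply: eq_bigr => n _; field.
rewrite -mulr_suml inner; case: ifP => _; last by rewrite mul0r.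
by rewrite mulrA.
Qed.

End Conorms.

(** The coefficients of the lambda_w in [trop_prod_lambda] are all 1 for n and
    are signs for m; at w = 0, where lambda_w may be negative, both are 1. *)
Lemma trop_prod_le_annihilated (R : realType) (Q : 'M[R]_4) (m n : characteristic)
    (N : {vspace characteristic}) :
  (forall w, w != 0 -> 0 <= lambda Q w) ->
  {in annihilates N, forall w, dot w n.1 = 0} ->
  trop_prod Q m N <= trop_prod Q n N.
Proof.
move=> lam0 wn; rewrite !trop_prod_lambda ler_wpM2l ?divr_ge0 //.
apply: ler_sum => w Nw; rewrite wn // expr0 mul1r.
have [->|w0] := eqVneq w 0; first by rewrite dot0l mul1r.
case: (F2_eq01 (dot w m.1)) => ->; rewrite ?mul1r // expr1 mulN1r.
by rewrite ge0_cp ?lam0.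
Qed.

Lemma max_attained_twice_of_le (R : realType) (a b c : R) :
  [\/ (a = b /\ c <= a), (a = c /\ b <= a) | (b = c /\ a <= b)] ->
  max_attained_twice a b c.
Proof.
rewrite /max_attained_twice /= => -[] [<- h].
- by apply: Or31; rewrite maxA maxxx (max_idPl h).
- by apply: Or32; rewrite (max_idPr h) maxxx.
- by apply: Or33; rewrite maxxx (max_idPr h).
Qed.

(** * The position of the characteristics of a datum relative to N *)

Section Datum.
Variable N : {vspace characteristic}.
Implicit Types (m n v : characteristic) (w : F2_4).

Definition even_coset m := {in N, forall n, qchar (m + n) = 0}.

Lemma even_coset_q m : even_coset m -> qchar m = 0.
Proof. by move=> /(_ 0 (mem0v _)); rewrite addr0. Qed.

Lemma even_coset_symp m n : even_coset m -> n \in N -> symp m n = qchar n.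
Proof.
move=> mE nN; have := mE n nN; rewrite qcharD even_coset_q // add0r.
by case: (F2_eq01 (qchar n)) => ->; case: (F2_eq01 (symp m n)) => ->.
Qed.

(** On N the quadratic form q coincides with the linear form <m, _>, so its
    polarization vanishes there. *)
Lemma even_coset_isotropic m : even_coset m -> isotropic N.
Proof.
move=> mE n p nN pN; have := even_coset_symp mE (memvD nN pN).
rewrite sympDr !(even_coset_symp mE) // qcharD => /eqP.
by rewrite -{1}[_ + _]addr0 (inj_eq (addrI _)) => /eqP.
Qed.

Lemma azygetic_symp m1 m2 m3 :
  qchar m1 = 0 -> qchar m2 = 0 -> qchar m3 = 0 ->
  azygetic m1 m2 m3 = (symp (m1 + m2) (m1 + m3) == 1).
Proof.
move=> q1 q2 q3; rewrite /azygetic !qcharD q1 q2 q3 !sympDl !sympDr sympvv.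
by congr (_ == 1); rewrite (sympC m2 m1); ring.
Qed.

(** Up to N, the vector v of N^perp is one of 0, m1 + m2, m1 + m3 and m2 + m3.
    In the first three cases m1 + v would lie in m1 + N, m2 + N or m3 + N, where
    q vanishes, whereas q (m1 + v) = q m1 + q v + <m1, v> = 1. *)
Lemma symp1_mem_coset m1 m2 m3 v : (3 <= \dim N)%N ->
  even_coset m1 -> even_coset m2 -> even_coset m3 ->
  symp (m1 + m2) (m1 + m3) = 1 ->
  {in N, forall n, symp v n = 0} -> qchar v = 0 -> symp m1 v = 1 ->
  m2 + m3 + v \in N.
Proof.
move=> dN E1 E2 E3 s12 vN qv m1v.
have h : {in N, forall n,
    [/\ symp (m1 + m2) n = 0, symp (m1 + m3) n = 0 & symp v n = 0]}.
  move=> n nN; rewrite vN // !sympDl !even_coset_symp //.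
  by split=> //; apply: addF2r.
have := orth_isotropic_codim1 (even_coset_isotropic E1) dN h s12.
have odd_m1v : qchar (m1 + v) = 1.
  by rewrite qcharD even_coset_q // qv m1v !add0r.
have nmem m : even_coset m -> m + (m1 + v) \notin N.
  move=> mE; apply/negP => /mE; rewrite addrA addF2 add0r odd_m1v.
  by move/eqP; rewrite oner_eq0.
have v_eq m : v + (m1 + m) = m + (m1 + v) by rewrite addrCA addrA addrC.
case: (F2_eq01 (symp v (m1 + m3))) => ->;
  case: (F2_eq01 (symp v (m1 + m2))) => ->; rewrite ?scale0r ?scale1r ?addr0.
- by rewrite -[v]add0r -(addF2 m1) -addrA (negPf (nmem _ E1)).
- by rewrite v_eq (negPf (nmem _ E3)).
- by rewrite v_eq (negPf (nmem _ E2)).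
- by rewrite -addrA addrACA addF2 add0r addrC.
Qed.

(** Both (0, w) in m2 + m3 + N and (0, w') in m1 + m3 + N by
    [symp1_mem_coset], hence
    0 = <(0, w), (0, w')> = <m2 + m3, m1 + m3> = <m1 + m2, m1 + m3> = 1. *)
Lemma annihilator_sees_one m1 m2 m3 (w w' : F2_4) : (3 <= \dim N)%N ->
  even_coset m1 -> even_coset m2 -> even_coset m3 ->
  symp (m1 + m2) (m1 + m3) = 1 ->
  annihilates N w -> annihilates N w' ->
  dot w m1.1 = 1 -> dot w' m2.1 = 1 -> False.
Proof.
move=> dN E1 E2 E3 s12 /forall_inP Nw /forall_inP Nw' w1 w2.
have symp0 u m : symp (0, u) m = dot u m.1 by rewrite /symp /= dot0l add0r.
have q0 (u : F2_4) : qchar (0, u) = 0 by apply: dot0l.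
have N1 : m2 + m3 + (0, w) \in N.
  apply: (symp1_mem_coset dN E1) => //.
    by move=> n nN; rewrite symp0 (eqP (Nw _ nN)).
  by rewrite sympC symp0.
have N2 : m1 + m3 + (0, w') \in N.
  apply: (symp1_mem_coset dN E2) => //.
  - by rewrite -s12 !sympDl !sympDr !sympvv (sympC m2 m1); ring.
  - by move=> n nN; rewrite symp0 (eqP (Nw' _ nN)).
  - by rewrite sympC symp0.
have w13 : symp (0, w) (m1 + m3) = 0.
  have : symp (0, w) (m1 + m3 + (0, w')) = 0 by rewrite symp0 (eqP (Nw _ N2)).
  by rewrite sympDr [symp _ (0, w')]symp0 dotC dot0l addr0.
have : symp (m2 + m3 + (0, w)) (m1 + m3) = 0.
  by rewrite sympC sympDl !even_coset_symp // addF2r.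
rewrite sympDl w13 addr0 => h; move: s12.
have -> : symp (m1 + m2) (m1 + m3) = symp (m2 + m3) (m1 + m3).
  by rewrite !sympDl !sympDr !sympvv (sympC m3 m1); ring.
by rewrite h => /eqP; rewrite eq_sym oner_eq0.
Qed.

Lemma two_annihilated m1 m2 m3 : (3 <= \dim N)%N ->
  even_coset m1 -> even_coset m2 -> even_coset m3 -> azygetic m1 m2 m3 ->
  let ann m := {in annihilates N, forall w, dot w m.1 = 0} in
  [\/ ann m1 /\ ann m2, ann m1 /\ ann m3 | ann m2 /\ ann m3].
Proof.
move=> dN E1 E2 E3; rewrite azygetic_symp ?even_coset_q // => /eqP s12 ann.
have annP m : ann m \/ exists2 w, annihilates N w & dot w m.1 = 1.
  have [/exists_inP[w Nw /eqP wm]|/exists_inPn h] :=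
    boolP [exists w in annihilates N, dot w m.1 == 1].
    by right; exists w.
  left=> w /h; case: (F2_eq01 (dot w m.1)) => -> //; by rewrite eqxx.
have s13 : symp (m1 + m3) (m1 + m2) = 1 by rewrite sympC.
have s23 : symp (m2 + m3) (m2 + m1) = 1.
  by rewrite -s12 !sympDl !sympDr !sympvv (sympC m3 m2) (sympC m3 m1); ring.
have [a1|[w1 N1 w1m]] := annP m1; have [a2|[w2 N2 w2m]] := annP m2.
- by apply: Or31.
- have [a3|[w3 N3 w3m]] := annP m3; first by apply: Or32.
  by case: (annihilator_sees_one dN E2 E3 E1 s23 N2 N3).
- have [a3|[w3 N3 w3m]] := annP m3; first by apply: Or33.
  by case: (annihilator_sees_one dN E1 E3 E2 s13 N1 N3).
- by case: (annihilator_sees_one dN E1 E2 E3 s12 N1 N2).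
Qed.

End Datum.

(** Two of the three products are at least as large as the others by
    [trop_prod_le_annihilated], in particular each other. *)
Lemma trop_condition_of_conorm_ge0 (R : realType) (Q : 'M[R]_4) m1 m2 m3 N :
  (forall e : 'Hom(F2_4, ('F_2)^o), e != 0 -> 0 <= conorm Q e) ->
  schottky_igusa m1 m2 m3 N -> trop_condition Q m1 m2 m3 N.
Proof.
move=> Qge0 [azy dN evenN].
have lam0 w := lambda_ge0 (w := w) Qge0.
have E m : (translate m N \subset
    (translate m1 N :|: translate m2 N :|: translate m3 N))%SET ->
    even_coset N m.
  by move=> /fintype.subsetP sub n nN; apply/eqP/evenN/sub/imset_f.
have E1 : even_coset N m1 by apply: E; rewrite -finset.setUA finset.subsetUl.
have E2 : even_coset N m2 by apply: E; rewrite finset.setUAC finset.subsetUr.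
have E3 : even_coset N m3 by apply: E; rewrite finset.subsetUr.
have le m n (h : {in annihilates N, forall w, dot w n.1 = 0}) :=
  trop_prod_le_annihilated m lam0 h.
apply: max_attained_twice_of_le.
have dN3 : (3 <= \dim N)%N by rewrite dN.
case: (two_annihilated dN3 E1 E2 E3 azy) => -[hi hj];
  [apply: Or31|apply: Or32|apply: Or33];
  by split; [apply/le_anti; rewrite !le|rewrite le].
Qed.

Theorem proposition7p9 (R : realType) :
  (forall Q : 'M[R]_4,
     posdef Q ->
     (forall e : 'Hom(F2_4, ('F_2)^o), e != 0 -> 0 <= conorm Q e) ->
     forall (m1 m2 m3 : characteristic) (N : {vspace characteristic}),
       schottky_igusa m1 m2 m3 N ->
       (\dim (fst_image N) <= 2)%N ->
       trop_condition Q m1 m2 m3 N) /\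
  (igusa_locus R `&`
     [set Q : 'M[R]_4 |
        forall (m1 m2 m3 : characteristic) (N : {vspace characteristic}),
          schottky_igusa m1 m2 m3 N ->
          (\dim (fst_image N) <= 2)%N ->
          trop_condition Q m1 m2 m3 N] = igusa_locus R)%classic.
Proof.
have cond (Q : 'M[R]_4) :
    (forall e : 'Hom(F2_4, ('F_2)^o), e != 0 -> 0 <= conorm Q e) ->
    forall m1 m2 m3 N, schottky_igusa m1 m2 m3 N -> trop_condition Q m1 m2 m3 N.
  by move=> Qge0 m1 m2 m3 N; apply: trop_condition_of_conorm_ge0.
split; first by move=> Q _ Qge0 m1 m2 m3 N datum _; apply: cond.
apply/seteqP; split=> [Q []//|Q Qig]; split=> // m1 m2 m3 N datum _.
by apply: cond datum; case: Qig.
Qed.
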